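(* Let $U\subset\mathcal{H}$ be an open set, and let functions $f_i\colon U\to\mathbb{R}$, $i\in I=\{1,\dots,m\}$, be continuously codifferentiable on $U$. Then the functions $f=\max_{i\in I}f_i$ and $g=\min_{i\in I}f_i$ are continuously codifferentiable on $U$ as well, and for any $x\in U$ one can define $$Df(x)=\Big[\operatorname{co}\Big\{\{(f_i(x)-f(x),0)\}+\underline{d}f_i(x)-\sum_{j\ne i}\overline{d}f_j(x)\ \Big|\ i\in I\Big\},\ \sum_{i\in I}\overline{d}f_i(x)\Big],$$ $$Dg(x)=\Big[\sum_{i\in I}\underline{d}f_i(x),\ \operatorname{co}\Big\{\{(f_i(x)-g(x),0)\}+\overline{d}f_i(x)-\sum_{j\ne i}\underline{d}f_j(x)\ \Big|\ i\in I\Big\}\Big]$$ (where $\operatorname{co}\{C_i\mid i\in I\}$ denotes the convex hull of $\bigcup_{i\in I}C_i$). Furthermore, for all $x\in U$, $r>0$ with $B(x,r)\subset U$, $\Delta x\in B(0,r)$ and $\alpha\in(0,1]$ one has $$\max\big\{|\varepsilon_f(\alpha,\Delta x,x,r)|,\ |\varepsilon_g(\alpha,\Delta x,x,r)|\big\}\le\max_{i\in I}|\varepsilon_{f_i}(\alpha,\Delta x,x,r)|.$$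
   Context: $\mathcal{H}$ is a real Hilbert space with inner product $\langle\cdot,\cdot\rangle$, $B(y,r)=\{z\in\mathcal{H}\mid\|z-y\|\le r\}$. A function $f$ defined in a neighbourhood of $x$ is codifferentiable at $x$ if there exist (nonempty) weakly compact convex sets $\underline{d}f(x),\overline{d}f(x)\subset\mathbb{R}\times\mathcal{H}$ such that for any $\Delta x\in\mathcal{H}$ $$\lim_{\alpha\to+0}\frac1\alpha\Big|f(x+\alpha\Delta x)-f(x)-\max_{(a,v)\in\underline{d}f(x)}(a+\alpha\langle v,\Delta x\rangle)-\min_{(b,w)\in\overline{d}f(x)}(b+\alpha\langle w,\Delta x\rangle)\Big|=0$$ and $\max_{(a,v)\in\underline{d}f(x)}a+\min_{(b,w)\in\overline{d}f(x)}b=0$. The pair $Df(x)=[\underline{d}f(x),\overline{d}f(x)]$ is called a codifferential of $f$ at $x$ (it is not unique). Throughout, codifferentials are normalized: $\max_{(a,v)\in\underline{d}f(x)}a=\min_{(b,w)\in\overline{d}f(x)}b=0$. A function is continuously codifferentiable on $U$ if it is codifferentiable at every point of $U$ and there is a codifferential mapping $x\mapsto Df(x)$ such that $\underline{d}f(\cdot)$, $\overline{d}f(\cdot)$ are Hausdorff continuous on $U$; for continuously codifferentiable functions only such continuous codifferential mappings are considered. ''One can define $Df(x)=\dots$'' means that the given formula, built from the continuous codifferential mappings of the $f_i$, defines a continuous codifferential mapping. For $B(x,r)\subset U$, $\Delta x\in B(0,r)$, $\alpha\in(0,1]$, $$\varepsilon_f(\alpha,\Delta x,x,r)=\frac1\alpha\Big(f(x+\alpha\Delta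 x)-f(x)-\max_{(a,v)\in\underline{d}f(x)}(a+\alpha\langle v,\Delta x\rangle)-\min_{(b,w)\in\overline{d}f(x)}(b+\alpha\langle w,\Delta x\rangle)\Big),$$ computed with the chosen codifferential (for $f$ and $g$: the ones given by the formulas). *)

(* Defs.v *)
From HB Require Import structures.
From mathcomp Require Import all_boot all_order all_algebra.
From mathcomp Require Import sesquilinear.
From mathcomp Require Import all_classical all_reals all_analysis.

Set Implicit Arguments.
Unset Strict Implicit.
Unset Printing Implicit Defensive.

Import Order.TTheory GRing.Theory Num.Theory.
Import numFieldNormedType.Exports.

Local Open Scope classical_set_scope.
Local Open Scope ring_scope.

HB.mixin Record NormedModule_isHilbert (R : realType) H
    of CompleteNormedModule R H := {
  inner : {dot H for (@idfun R)} ;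
  inner_normE : forall x : H, inner x x = `|x| ^+ 2
}.

#[short(type="hilbertType")]
HB.structure Definition Hilbert (R : realType) :=
  {H of CompleteNormedModule R H & NormedModule_isHilbert R H}.

Notation "'[ u , v ]" := (inner u v) : ring_scope.

Section sets.
Context {R : realType}.

(* The greatest (resp. least) element of A when there is one, and 0 otherwise;
   every set it is applied to below is the image of a nonempty weakly compact
   set under a continuous affine functional, so that the extremum exists. *)
Definition set_max (A : set R) : R := xget 0 (A `&` ubound A).
Definition set_min (A : set R) : R := xget 0 (A `&` lbound A).

Definition fin_max m (F : 'I_m.+1 -> R) : R :=
  \big[Num.max/F ord0]_(i < m.+1) F i.
Definition fin_min m (F : 'I_m.+1 -> R) : R :=
  \big[Num.min/F ord0]_(i < m.+1) F i.

Definition set_add {V : zmodType} (A B : set V) : set V :=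
  [set a + b | a in A & b in B].
Definition set_sub {V : zmodType} (A B : set V) : set V :=
  [set a - b | a in A & b in B].

Definition convex_hull {V : lmodType R} (A : set V) : set V :=
  smallest (@convex_set R V) A.

Definition hausdorff_dist {X : pseudoMetricType R} (A B : set X) : \bar R :=
  maxe (ereal_sup [set edist_inf B a | a in A])
       (ereal_sup [set edist_inf A b | b in B]).

Definition hausdorff_continuous {T : topologicalType} {X : pseudoMetricType R}
    (U : set T) (F : T -> set X) : Prop :=
  forall x, U x -> hausdorff_dist (F y) (F x) @[y --> within U (nbhs x)] --> 0%E.

Definition topological_dual (E : normedModType R) : Type :=
  {phi : {linear E -> R^o} | continuous phi}.

HB.instance Definition _ (E : normedModType R) :=
  gen_eqMixin (topological_dual E).
HB.instance Definition _ (E : normedModType R) :=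
  gen_choiceMixin (topological_dual E).

Definition dual_eval (E : normedModType R) (x : E) :
  {ptws (topological_dual E) -> R^o} := fun phi => sval phi x.

(* The initial topology of dual_eval is the weak topology of E: the coarsest
   one making every continuous linear functional continuous. *)
Definition weakly_compact {E : normedModType R} (K : set E) : Prop :=
  @compact (initial_topology (@dual_eval E)) K.

End sets.

Section codifferential.
Context {R : realType} {H : hilbertType R}.
Implicit Types (f : H -> R) (x y : H) (U : set H).

Local Notation RH := (R^o * H)%type.

(* A pair [lower set, upper set] of subsets of R x H. *)
Definition codiff_pair : Type := (set RH * set RH)%type.
Implicit Type D : codiff_pair.

Definition codiff_remainder f D x (dx : H) (alpha : R) : R :=
  f (x + alpha *: dx) - f x
  - set_max [set z.1 + alpha * '[z.2, dx] | z in D.1]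
  - set_min [set z.1 + alpha * '[z.2, dx] | z in D.2].

(* The error epsilon_f(alpha, dx, x, r): the radius r only restricts the range
   of dx and does not enter the formula. *)
Definition codiff_error f D x (dx : H) (alpha : R) : R :=
  alpha^-1 * codiff_remainder f D x dx alpha.

Definition weakly_compact_convex (C : set RH) : Prop :=
  [/\ C !=set0, weakly_compact C & convex_set C].

Definition is_codifferential f x D : Prop :=
  [/\ weakly_compact_convex D.1, weakly_compact_convex D.2,
      forall dx : H,
        alpha^-1 * `|codiff_remainder f D x dx alpha| @[alpha --> 0^'+] --> 0 &
      set_max [set z.1 | z in D.1] + set_min [set z.1 | z in D.2] = 0].

Definition codifferentiable f x : Prop := exists D, is_codifferential f x D.

Definition normalized D : Prop :=
  set_max [set z.1 | z in D.1] = 0 /\ set_min [set z.1 | z in D.2] = 0.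

(* Functions on U and mappings x |-> Df(x) on U are represented by total
   functions; only their values on the open set U matter. *)
Definition is_continuous_codifferential U f (Df : H -> codiff_pair) : Prop :=
  [/\ forall x, U x -> is_codifferential f x (Df x) /\ normalized (Df x),
      hausdorff_continuous U (fun x => (Df x).1) &
      hausdorff_continuous U (fun x => (Df x).2)].

Definition continuously_codifferentiable U f : Prop :=
  (forall x, U x -> codifferentiable f x) /\
  exists Df, is_continuous_codifferential U f Df.

Section max_min.
Variables (m : nat) (f_ : 'I_m.+1 -> H -> R) (D_ : 'I_m.+1 -> H -> codiff_pair).

Definition max_fun x : R := fin_max (fun i => f_ i x).
Definition min_fun x : R := fin_min (fun i => f_ i x).

Definition max_codiff x : codiff_pair :=
  (convex_hull (\bigcup_(i : 'I_m.+1)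
     set_sub
       (set_add [set (f_ i x - max_fun x, 0) : RH] (D_ i x).1)
       (\big[set_add/[set 0]]_(j < m.+1 | j != i) (D_ j x).2)),
   \big[set_add/[set 0]]_(i < m.+1) (D_ i x).2).

Definition min_codiff x : codiff_pair :=
  (\big[set_add/[set 0]]_(i < m.+1) (D_ i x).1,
   convex_hull (\bigcup_(i : 'I_m.+1)
     set_sub
       (set_add [set (f_ i x - min_fun x, 0) : RH] (D_ i x).2)
       (\big[set_add/[set 0]]_(j < m.+1 | j != i) (D_ j x).1))).

End max_min.
End codifferential.

(* Main.v *)
From HB Require Import structures.
Require Import Defs.
From mathcomp Require Import all_boot all_order all_algebra.
From mathcomp Require Import sesquilinear lra ring.
From mathcomp Require Import all_classical all_reals all_analysis.

Import Order.TTheory GRing.Theory Num.Theory.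
Import numFieldNormedType.Exports.

Local Open Scope classical_set_scope.
Local Open Scope ring_scope.

Set Implicit Arguments.
Unset Strict Implicit.
Unset Printing Implicit Defensive.

(** The formulas rest on one identity: f_i (x) plus the maximum and the
    minimum given by a codifferential of f_i is an approximation of
    f_i (x + alpha dx), and taking the maximum over i of these approximations
    gives again an expression of the form maximum plus minimum.  Write S_i for
    the maximum over the lower set of f_i and T_i for the minimum over its
    upper set.  Adding and subtracting the sum of all the T_j turns
    max_i (f_i (x) + S_i + T_i) into
<<
    f (x) + max_i (f_i (x) - f (x) + S_i - sum_(j != i) T_j) + sum_j T_j
>>
    whose last two terms are the maximum over the convex hull and the minimum
    over the sum in the statement ([max_codiff_lower], [max_codiff_upper]):
    extrema of a linear functional are additive under Minkowski sums and do
    not change under convex hulls.  So the remainder of f is the difference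
    between the maximum of the exact values and the maximum of the
    approximations ([max_codiff_remainder]), and the maximum is 1-Lipschitz in
    the sup norm ([fin_max_dist]).  This gives the bound on the errors, and
    with it the codifferentiability of f at each point.

    Weak compactness of the new sets follows since each one is a continuous
    image of a product of weakly compact sets (and of a segment, for the hull
    of two convex sets, [convex_hull_join]).  Hausdorff continuity passes
    through sums, opposites, finite unions and convex hulls with explicit
    moduli.  The translations by (f_i (x) - f (x), 0) also require that the f_i
    be continuous.  Codifferentiability at a point only controls f_i along
    rays; but weakly compact sets are bounded, by the uniform boundedness
    principle, and Hausdorff continuity makes the bound locally uniform.  Hence
    f_i is locally Lipschitz by a mean value inequality along segments
    ([continuous_codifferential_continuous]).

    The minimum is reduced to the maximum by changing signs: exchanging the
    opposites of the two sets of a codifferential of f gives one of - f, with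
    the opposite remainder ([codiff_remainder_opp], [min_codiffE]). *)

(** * Opposites, Minkowski sums and convex hulls *)

Section minkowski.
Context {R : realType} {V : lmodType R}.
Implicit Types (A B C : set V) (a b : V).

Definition set_opp A : set V := [set - a | a in A].

Lemma set_oppK A : set_opp (set_opp A) = A.
Proof.
apply/seteqP; split=> [_ [_ [a Aa <-] <-]|a Aa]; first by rewrite opprK.
by exists (- a); [exists a|rewrite opprK].
Qed.

Lemma set_opp1 a : set_opp [set a] = [set - a].
Proof. by rewrite /set_opp image_set1. Qed.

Lemma set_oppD A B : set_opp (set_add A B) = set_add (set_opp A) (set_opp B).
Proof.
apply/seteqP; split=> [_ [_ [a Aa] [b Bb] <- <-]|].
  by rewrite opprD; exists (- a); [exists a|exists (- b); [exists b|]].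
move=> _ [_ [a Aa <-]] [_ [b Bb <-] <-]; exists (a + b); last by rewrite opprD.
by exists a => //; exists b.
Qed.

Lemma set_subE A B : set_sub A B = set_add A (set_opp B).
Proof.
apply/seteqP; split=> [_ [a Aa] [b Bb] <-|_ [a Aa] [_ [b Bb <-]] <-].
  by exists a => //; exists (- b) => //; exists b.
by exists a => //; exists b.
Qed.

Lemma set_opp_sum (I : Type) (s : seq I) (P : pred I) (F : I -> set V) :
  set_opp (\big[set_add/[set 0]]_(i <- s | P i) F i) =
  \big[set_add/[set 0]]_(i <- s | P i) set_opp (F i).
Proof.
apply: (big_morph set_opp) => [A B|]; first exact: set_oppD.
by rewrite set_opp1 oppr0.
Qed.

Lemma set_opp_bigcup (I : Type) (P : set I) (F : I -> set V) :
  set_opp (\bigcup_(i in P) F i) = \bigcup_(i in P) set_opp (F i).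
Proof. by rewrite /set_opp image_bigcup. Qed.

End minkowski.

Section convexity.
Context {R : realType} {V : lmodType R}.
Implicit Types (A B C : set V) (a b : V).

Lemma convex_setP C : @convex_set R V C <->
  forall p q : R, 0 <= p -> 0 <= q -> p + q = 1 ->
    forall x y, C x -> C y -> C (p *: x + q *: y).
Proof.
split=> [cC p q p0 q0 pq x y Cx Cy|cC x y t]; last first.
  rewrite !inE => Cx Cy; apply: cC => //; last first.
  exact: subrKC.
  by rewrite subr_ge0.
have p1 : p <= 1 by rewrite -pq lerDl.
have := cC x y (Itv01 p0 p1); rewrite !inE => /(_ Cx Cy).
have -> : q = 1 - p by rewrite -pq addrC addKr.
by [].
Qed.

(** The two weights are free and the combination is not normalized, so that
    convex combinations of convex combinations need no case analysis on
    vanishing total weights. *)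
Lemma convex_set_cone C : @convex_set R V C ->
  forall p q : R, 0 <= p -> 0 <= q -> forall x y, C x -> C y ->
    exists2 z, C z & p *: x + q *: y = (p + q) *: z.
Proof.
move=> /convex_setP cC p q p0 q0 x y Cx Cy.
have := addr_ge0 p0 q0; rewrite le_eqVlt => /predU1P[/esym pq0|pq_gt0].
  exists x => //; move/eqP: (pq0); rewrite paddr_eq0// => /andP[/eqP -> /eqP ->].
  by rewrite addr0 !scale0r addr0.
have pqN0 := lt0r_neq0 pq_gt0.
exists ((p / (p + q)) *: x + (q / (p + q)) *: y).
  apply: cC => //; rewrite ?divr_ge0//; try exact: ltW.
  by rewrite -mulrDl divff.
by rewrite scalerDr !scalerA ![(p + q) * _]mulrC !divfK.
Qed.

Lemma convex_set1 a : @convex_set R V [set a].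
Proof.
by apply/convex_setP => p q _ _ pq _ _ -> ->; rewrite -scalerDl pq scale1r.
Qed.

Lemma convex_set_opp A : @convex_set R V A -> @convex_set R V (set_opp A).
Proof.
move=> /convex_setP cA; apply/convex_setP => p q p0 q0 pq _ _ [x Ax <-] [y Ay <-].
by exists (p *: x + q *: y); [exact: cA|rewrite !scalerN opprD].
Qed.

Lemma convex_set_add A B :
  @convex_set R V A -> @convex_set R V B -> @convex_set R V (set_add A B).
Proof.
move=> /convex_setP cA /convex_setP cB; apply/convex_setP.
move=> p q p0 q0 pq _ _ [a Aa] [b Bb] <- [c Ac] [d Bd] <-.
exists (p *: a + q *: c); first exact: cA.
exists (p *: b + q *: d); first exact: cB.
by rewrite !scalerDr addrACA.
Qed.

Lemma convex_hull_convex A : @convex_set R V (convex_hull A).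
Proof.
apply/convex_setP => p q p0 q0 pq x y hx hy C [cC AC].
by move/convex_setP: (cC); apply => //; [apply: hx|apply: hy].
Qed.

Lemma sub_convex_hull A : A `<=` convex_hull A.
Proof. exact: sub_gen_smallest. Qed.

Lemma convex_hull_min A C :
  @convex_set R V C -> A `<=` C -> convex_hull A `<=` C.
Proof. by move=> cC AC x; apply. Qed.

Lemma convex_hull_id C : @convex_set R V C -> convex_hull C = C.
Proof.
move=> cC; apply/seteqP; split; first exact: convex_hull_min.
exact: sub_convex_hull.
Qed.

Lemma set_opp_convex_hull A : set_opp (convex_hull A) = convex_hull (set_opp A).
Proof.
have sub B : set_opp (convex_hull B) `<=` convex_hull (set_opp B).
  suff : convex_hull B `<=` set_opp (convex_hull (set_opp B)).
    by move=> /(image_subset -%R); rewrite -!/(set_opp _) set_oppK.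
  apply: convex_hull_min; first exact/convex_set_opp/convex_hull_convex.
  rewrite -[X in X `<=` _]set_oppK; apply: image_subset.
  exact: sub_convex_hull.
apply/seteqP; split; first exact: sub.
by have /(image_subset -%R) := @sub (set_opp A); rewrite -!/(set_opp _) !set_oppK.
Qed.

(** Allows the hull of a finite union to be built one set at a time. *)
Lemma convex_hullU A B : convex_hull (A `|` B) = convex_hull (A `|` convex_hull B).
Proof.
apply/seteqP; split; apply: convex_hull_min; try exact: convex_hull_convex.
  by move=> x [Ax|Bx]; apply: sub_convex_hull; [left|right; exact: sub_convex_hull].
move=> x [Ax|]; first by apply: sub_convex_hull; left.
apply: convex_hull_min; first exact: convex_hull_convex.
by move=> y By; apply: sub_convex_hull; right.
Qed.

(** Segments joining the two sets suffice, by convexity of each of them; this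
    displays the hull as an image of a product with a compact interval. *)
Lemma convex_hull_join A B : A !=set0 -> B !=set0 ->
  @convex_set R V A -> @convex_set R V B ->
  convex_hull (A `|` B) =
  [set z.1 *: z.2.1 + (1 - z.1) *: z.2.2 | z in `[0 : R, 1] `*` (A `*` B)].
Proof.
move=> [a0 Aa0] [b0 Bb0] cA cB; apply/seteqP; split; last first.
  move=> _ [[t [a b]] /= [t01 [Aa Bb]] <-].
  move: t01; rewrite /= in_itv/= => /andP[t0 t1].
  move/convex_setP: (@convex_hull_convex (A `|` B)); apply => //=.
  - by rewrite subr_ge0.
  - by rewrite addrC subrK.
  - by apply: sub_convex_hull; left.
  - by apply: sub_convex_hull; right.
apply: convex_hull_min; last first.
  move=> x [Ax|Bx].
  - exists (1, (x, b0)); last by rewrite /= subrr scale0r addr0 scale1r.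
    by split=> //=; rewrite in_itv/= ler01 lexx.
  - exists (0, (a0, x)); last by rewrite /= subr0 scale0r add0r scale1r.
    by split=> //=; rewrite in_itv/= ler01 lexx.
apply/convex_setP => p q p0 q0 pq x y.
move=> [[t [a b]] /= [+ [Aa Bb]] <-] [[s [c d]] /= [+ [Ac Bd]] <-].
rewrite /= !in_itv/= => /andP[t0 t1] /andP[s0 s1].
have [z Az zE] :=
  convex_set_cone cA (mulr_ge0 p0 t0) (mulr_ge0 q0 s0) Aa Ac.
have t1' : 0 <= 1 - t by rewrite subr_ge0.
have s1' : 0 <= 1 - s by rewrite subr_ge0.
have [w Bw wE] :=
  convex_set_cone cB (mulr_ge0 p0 t1') (mulr_ge0 q0 s1') Bb Bd.
exists (p * t + q * s, (z, w)) => /=.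
  split=> //=; rewrite in_itv/=; apply/andP; split; nra.
have -> : 1 - (p * t + q * s) = p * (1 - t) + q * (1 - s) by lra.
by rewrite -zE -wE !scalerDr !scalerA addrACA.
Qed.

End convexity.

(** * Greatest values of linear functionals *)

Section greatest_element.
Context {R : realType}.
Implicit Types (A : set R) (M : R).

(** A relational form of [set_max]: unlike the value, it records that the
    maximum is attained. *)
Definition is_greatest A M := A M /\ ubound A M.

Lemma is_greatest_max A M : is_greatest A M -> set_max A = M.
Proof.
move=> [AM uM]; apply: xget_unique => [//|N [AN uN]].
by apply/le_anti; rewrite uM//= uN.
Qed.

(** The default value 0 makes this hold even when there is no least element. *)
Lemma set_minE A : set_min A = - set_max [set - a | a in A].
Proof.
have minP M : (A `&` lbound A) M <->
    is_greatest [set - a | a in A] (- M).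
  split=> [[AM lM]|[[a Aa /oppr_inj <-] uM]].
    by split; [exists M|move=> _ [a Aa <-]; rewrite lerN2; exact: lM].
  by split=> // b Ab; rewrite -lerN2; apply: uM; exists b.
rewrite /set_min; case: xgetP => [M _ /minP/is_greatest_max ->|noM].
  by rewrite opprK.
rewrite /set_max xgetPN ?oppr0// => M.
by rewrite -[M]opprK => /minP; exact: noM.
Qed.

Lemma is_greatest_image (T : Type) (C : set T) (l : T -> R) M :
  is_greatest (l @` C) M <->
  (exists2 z, C z & l z = M) /\ forall z, C z -> l z <= M.
Proof.
split=> [[CM uM]|[CM uM]]; split=> //.
  by move=> z Cz; apply: uM; exists z.
by move=> _ [z Cz <-]; exact: uM.
Qed.

End greatest_element.

Section finite_maximum.
Context {R : realType} (m : nat).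
Implicit Types F G : 'I_m.+1 -> R.

Lemma fin_max_ge F i : F i <= fin_max F.
Proof. exact: le_bigmax. Qed.

Lemma fin_max_attained F : exists i, fin_max F = F i.
Proof.
apply: (big_ind (fun v => exists i, v = F i)) => [|_ _ [i ->] [j ->]|i _].
- by exists ord0.
- by rewrite maxEle; case: ifP => _; [exists j|exists i].
- by exists i.
Qed.

Lemma fin_max_le F M : (forall i, F i <= M) -> fin_max F <= M.
Proof. by move=> FM; have [i ->] := fin_max_attained F. Qed.

Lemma fin_max_eq F i : (forall j, F j <= F i) -> fin_max F = F i.
Proof. by move=> Fi; apply/le_anti; rewrite fin_max_ge fin_max_le. Qed.

Lemma fin_minE F : fin_min F = - fin_max (fun i => - F i).
Proof.
rewrite /fin_min /fin_max.
apply: (big_rec2 (fun a b => a = - b)); first by rewrite opprK.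
by move=> i a b _ ->; rewrite oppr_max opprK.
Qed.

Lemma fin_maxDr F c : fin_max (fun i => F i + c) = fin_max F + c.
Proof.
have [i Fi] := fin_max_attained F; rewrite Fi.
by apply: (fin_max_eq (F := fun i => F i + c)) => j; rewrite lerD2r -Fi fin_max_ge.
Qed.

Lemma fin_max_dist F G M :
  (forall i, `|F i - G i| <= M) -> `|fin_max F - fin_max G| <= M.
Proof.
move=> FG.
have half F' G' : (forall i, `|F' i - G' i| <= M) -> fin_max F' - fin_max G' <= M.
  move=> {}FG; rewrite lerBlDr; apply: fin_max_le => i.
  by have := FG i; have := fin_max_ge G' i; rewrite ler_norml; lra.
rewrite ler_norml half// andbT lerNl opprB half// => i.
by rewrite distrC.
Qed.

End finite_maximum.

(** Greatest values of a linear functional are additive under Minkowski sums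
    and unchanged by convex hulls; this turns the set formulas for the
    codifferentials into identities between numbers. *)
Section support_function.
Context {R : realType} {V : lmodType R} (l : {linear V -> R^o}).
Implicit Types (A B C : set V) (M N : R).

Lemma is_greatest_set1 a : is_greatest (l @` [set a]) (l a : R).
Proof. by apply/is_greatest_image; split=> [|_ -> //]; exists a. Qed.

Lemma is_greatest_add A B M N :
  is_greatest (l @` A) M -> is_greatest (l @` B) N ->
  is_greatest (l @` set_add A B) (M + N).
Proof.
move=> /is_greatest_image[[a Aa <-] uA] /is_greatest_image[[b Bb <-] uB].
apply/is_greatest_image; split=> [|_ [c Ac] [d Bd] <-].
  by exists (a + b); [exists a => //; exists b|rewrite linearD].
by rewrite linearD lerD ?uA ?uB.
Qed.

Lemma is_greatest_sum (I : Type) (s : seq I) (P : pred I)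
    (C : I -> set V) (M : I -> R) :
  (forall i, P i -> is_greatest (l @` C i) (M i)) ->
  is_greatest (l @` \big[set_add/[set 0]]_(i <- s | P i) C i)
    (\sum_(i <- s | P i) M i).
Proof.
move=> CM; apply: (big_rec2 (fun A N => is_greatest (l @` A) N)).
  by have := is_greatest_set1 0; rewrite linear0.
by move=> i A N Pi; apply: is_greatest_add; exact: CM.
Qed.

Lemma is_greatest_hull A M :
  is_greatest (l @` A) M -> is_greatest (l @` convex_hull A) M.
Proof.
move=> /is_greatest_image[[a Aa aM] uA].
apply/is_greatest_image; split; first by exists a => //; exact: sub_convex_hull.
apply: (@convex_hull_min _ _ A [set z | (l z : R) <= M]) => [|//].
apply/convex_setP => p q p0 q0 pq x y /= xM yM.
rewrite linearD !linearZ/= -[leRHS]mul1r -pq mulrDl.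
by rewrite lerD// ler_wpM2l.
Qed.

Lemma is_greatest_bigcup m (C : 'I_m.+1 -> set V) (M : 'I_m.+1 -> R) :
  (forall i, is_greatest (l @` C i) (M i)) ->
  is_greatest (l @` \bigcup_i C i) (fin_max M).
Proof.
move=> CM; apply/is_greatest_image; split=> [|z [i _ Ciz]].
  have [i ->] := fin_max_attained M.
  have /is_greatest_image[[z Ciz zM] _] := CM i.
  by exists z => //; exists i.
have /is_greatest_image[_ uM] := CM i.
exact: le_trans (uM z Ciz) (fin_max_ge _ i).
Qed.

Lemma image_set_opp C : l @` set_opp C = [set - a | a in l @` C].
Proof. by rewrite /set_opp !image_comp; apply: eq_imagel => z _ /=; rewrite linearN. Qed.

Lemma set_min_linear C : set_min (l @` C) = - set_max (l @` set_opp C).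
Proof. by rewrite set_minE image_set_opp. Qed.

End support_function.

(** * Weak compactness *)

Section weak_compactness.
Context {R : realType} {E : normedModType R}.
Implicit Types (A B C : set E).

Local Notation W := (initial_topology (@dual_eval R E)).

(** Universal property of the weak topology; with it, the algebraic operations
    are weakly continuous because linear functionals respect them. *)
Lemma weak_continuous (T : topologicalType) (g : T -> W) :
  (forall phi : topological_dual E, continuous (sval phi \o g : T -> R^o)) ->
  continuous g.
Proof.
move=> cg; apply: continuous_comp_initial => t.
apply/cvg_sup => phi.
by move: t; apply: continuous_comp_initial; exact: cg.
Qed.

Lemma dual_weak_continuous (phi : topological_dual E) :
  continuous (sval phi : W -> R^o).
Proof.
move=> z; apply: (@continuous_comp W {ptws (topological_dual E) -> R^o} R^o
  (@dual_eval R E) (fun f => f phi)); first exact: initial_continuous.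
exact: (@proj_continuous (topological_dual E) (fun=> R^o)).
Qed.

Lemma weakly_compact_add A B :
  weakly_compact A -> weakly_compact B -> weakly_compact (set_add A B).
Proof.
move=> cA cB; pose g (z : W * W) : W := (z.1 : E) + z.2.
rewrite /weakly_compact; have -> : set_add A B = g @` (A `*` B).
  apply/seteqP; split=> [_ [a Aa] [b Bb] <-|_ [[a b] [Aa Bb] <-]].
    by exists (a, b).
  by exists a => //; exists b.
apply: (@continuous_compact (W * W)%type W g); last by apply: (@compact_setX W W).
apply: continuous_subspaceT; apply: weak_continuous => phi z.
have -> : sval phi \o g = (fun z : W * W => sval phi z.1 + sval phi z.2).
  by apply/funext => u; rewrite /g /= linearD.
apply: cvgD; (apply: continuous_comp; last exact: dual_weak_continuous).
  exact: cvg_fst.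
exact: cvg_snd.
Qed.

Lemma weakly_compact_opp A : weakly_compact A -> weakly_compact (set_opp A).
Proof.
move=> cA; pose g (z : W) : W := - (z : E).
apply: (@continuous_compact W W g) => //.
apply: continuous_subspaceT; apply: weak_continuous => phi z.
have -> : sval phi \o g = (fun z : W => - sval phi z).
  by apply/funext => u; rewrite /g /= linearN.
by apply: (@cvgN _ _ _ _ (@nbhs_filter W z)); exact: dual_weak_continuous.
Qed.

Lemma weakly_compact_hullU A B : A !=set0 -> B !=set0 ->
  convex_set A -> convex_set B -> weakly_compact A -> weakly_compact B ->
  weakly_compact (convex_hull (A `|` B)).
Proof.
move=> A0 B0 cvA cvB cA cB; rewrite convex_hull_join//.
apply: (@continuous_compact (R^o * (W * W))%type W); last first.
  by apply: compact_setX; [exact: segment_compact|by apply: (@compact_setX W W)].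
apply: continuous_subspaceT; apply: weak_continuous => phi z.
set g := _ \o _.
have -> : g = (fun z : R^o * (W * W) =>
    z.1 * sval phi z.2.1 + (1 - z.1) * sval phi z.2.2).
  by apply/funext => u; rewrite /g/= linearD !linearZ.
have c1 : z0.1 @[z0 --> z] --> z.1 by exact: cvg_fst.
have c2 : z0.2 @[z0 --> z] --> z.2 by exact: cvg_snd.
apply: cvgD; apply: cvgM => //.
- apply: (@continuous_comp _ _ _ (fun z : R^o * (W * W) => z.2.1) (sval phi)).
    by apply: continuous_comp; [exact: cvg_snd|exact: cvg_fst].
  exact: dual_weak_continuous.
- by apply: cvgB => //; exact: cvg_cst.
- apply: (@continuous_comp _ _ _ (fun z : R^o * (W * W) => z.2.2) (sval phi)).
    by apply: continuous_comp; [exact: cvg_snd|exact: cvg_snd].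
  exact: dual_weak_continuous.
Qed.

Lemma weakly_compact_greatest A (phi : topological_dual E) :
  A !=set0 -> weakly_compact A ->
  is_greatest (sval phi @` A) (set_max (sval phi @` A)).
Proof.
move=> A0 cA.
have [|c cA' maxc] := @compact_EVT_max W R (sval phi) A A0 cA.
  by apply: continuous_subspaceT; exact: dual_weak_continuous.
have gr : is_greatest (sval phi @` A) (sval phi c).
  apply/is_greatest_image; split=> [|z Az]; first by exists c => //; exact: set_mem.
  by apply: maxc; rewrite inE.
by rewrite (is_greatest_max gr).
Qed.

End weak_compactness.

Section weakly_compact_hull.
Context {R : realType} {E : normedModType R}.

Lemma weakly_compact_hull_bigcup m (C : 'I_m.+1 -> set E) :
  (forall i, C i !=set0) -> (forall i, convex_set (C i)) ->
  (forall i, weakly_compact (C i)) ->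
  weakly_compact (convex_hull (\bigcup_i C i)).
Proof.
move=> C0 cvC cC.
(* Sequences headed by some i avoid the empty union, whose hull is empty. *)
suff hull s i : weakly_compact (convex_hull (\bigcup_(j in [set` i :: s]) C j)).
  suff -> : [set: 'I_m.+1] = [set` ord0 :: enum 'I_m.+1] by exact: hull.
  by apply/seteqP; split=> j //= _; rewrite in_cons mem_enum orbT.
elim: s i => [|k s IHs] i.
  by rewrite set_cons1 bigcup_set1 convex_hull_id.
have -> : [set` i :: k :: s] = [set i] `|` [set` k :: s].
  apply/seteqP; split=> j /=; rewrite in_cons.
    by move=> /predU1P[->|?]; [left|right].
  by move=> [->|jks]; apply/orP; [left|right].
rewrite bigcup_setU bigcup_set1 convex_hullU.
apply: weakly_compact_hullU => //; last exact: convex_hull_convex.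
have [z Cz] := C0 k; exists z; apply: sub_convex_hull; exists k => //=.
by rewrite in_cons eqxx.
Qed.

End weakly_compact_hull.

(** * Hausdorff continuity *)

Section hausdorff_near.
Context {R : realType} {V : normedModType R}.
Implicit Types (A B C : set V) (e d : R).

Definition hausdorff_near e A B :=
  (forall a, A a -> exists2 b, B b & `|a - b| < e) /\
  (forall b, B b -> exists2 a, A a & `|a - b| < e).

Lemma hausdorff_near_sym e A B : hausdorff_near e A B -> hausdorff_near e B A.
Proof.
by move=> [AB BA]; split=> [b /BA|a /AB] [c]; exists c; rewrite // distrC.
Qed.

Lemma hausdorff_near_dist e A B : A !=set0 ->
  hausdorff_near e A B -> (0 <= hausdorff_dist A B <= e%:E)%E.
Proof.
move=> [a0 Aa0] [AB BA].
have half A' B' : (forall a, A' a -> exists2 b, B' b & `|a - b| < e) ->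
    (ereal_sup [set edist_inf B' a | a in A'] <= e%:E)%E.
  move=> sub; apply: ge_ereal_sup => _ [a Aa <-].
  have [b Bb abe] := sub a Aa.
  have e_gt0 : 0 < e by exact: le_lt_trans abe.
  apply: (@le_trans _ _ (edist (a, b))); last first.
    by apply: edist_fin => //=; rewrite -ball_normE.
  by apply: ereal_inf_lbound; exists b.
rewrite /hausdorff_dist ge_max half//= half ?andbT; last first.
  by move=> b /BA[a Aa]; exists a; rewrite // distrC.
rewrite le_max; apply/orP; left.
apply: (@le_trans _ _ (edist_inf B a0)); first exact: edist_inf_ge0.
by apply: ereal_sup_ubound; exists a0.
Qed.

Lemma hausdorff_dist_near e A B :
  (hausdorff_dist A B < e%:E)%E -> hausdorff_near e A B.
Proof.
have half A' B' : (ereal_sup [set edist_inf B' a | a in A'] < e%:E)%E ->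
    forall a, A' a -> exists2 b, B' b & `|a - b| < e.
  move=> sup_lt a Aa.
  have : (edist_inf B' a < e%:E)%E.
    by apply: le_lt_trans sup_lt; apply: ereal_sup_ubound; exists a.
  move=> /ereal_inf_lt[_ [b Bb <-]] abe; exists b => //.
  by have := edist_lt_ball abe; rewrite -ball_normE.
rewrite /hausdorff_dist gt_max => /andP[AB BA]; split; first exact: half.
by move=> b /(half _ _ BA)[a Aa]; exists a; rewrite // distrC.
Qed.

Lemma hausdorff_near_add e d A B C D :
  hausdorff_near e A C -> hausdorff_near d B D ->
  hausdorff_near (e + d) (set_add A B) (set_add C D).
Proof.
have half A' B' C' D' :
    (forall a, A' a -> exists2 c, C' c & `|a - c| < e) ->
    (forall b, B' b -> exists2 d', D' d' & `|b - d'| < d) ->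
    forall z, set_add A' B' z -> exists2 w, set_add C' D' w & `|z - w| < e + d.
  move=> AC BD _ [a Aa] [b Bb] <-.
  have [c Cc ace] := AC a Aa; have [d' Dd bdd] := BD b Bb.
  exists (c + d'); first by exists c => //; exists d'.
  by rewrite opprD addrACA (le_lt_trans (ler_normD _ _))// ltrD.
move=> /[dup] AC /hausdorff_near_sym CA /[dup] BD /hausdorff_near_sym DB.
split; first by apply: half; [case: AC|case: BD].
move=> z /(half _ _ _ _ CA.1 DB.1)[w Aw].
by exists w; rewrite // distrC.
Qed.

Lemma hausdorff_near_opp e A B :
  hausdorff_near e A B -> hausdorff_near e (set_opp A) (set_opp B).
Proof.
move=> [AB BA]; split=> _ [a /[dup] Aa + <-].
  move=> /AB[b Bb ab]; exists (- b); first by exists b.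
  by rewrite -opprD normrN.
move=> /BA[b Bb ab]; exists (- b); first by exists b.
by rewrite -opprD normrN.
Qed.

Lemma hausdorff_near_bigcup (I : Type) e (A B : I -> set V) :
  (forall i, hausdorff_near e (A i) (B i)) ->
  hausdorff_near e (\bigcup_i A i) (\bigcup_i B i).
Proof.
move=> AB; split=> [a [i _ Aia]|b [i _ Bib]].
  by have [b Bib ab] := (AB i).1 a Aia; exists b => //; exists i.
by have [a Aia ab] := (AB i).2 b Bib; exists a => //; exists i.
Qed.

(** The points within distance e of a convex set form a convex set, so an
    e-neighbourhood containing the generators contains their hull. *)
Lemma hausdorff_near_hull e A B :
  hausdorff_near e A B -> hausdorff_near e (convex_hull A) (convex_hull B).
Proof.
have half A' B' : (forall a, A' a -> exists2 b, B' b & `|a - b| < e) ->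
    forall a, convex_hull A' a -> exists2 b, convex_hull B' b & `|a - b| < e.
  move=> AB; apply: convex_hull_min => [|a /AB[b Bb ab]]; last first.
    by exists b => //; exact: sub_convex_hull.
  apply/convex_setP => p q p0 q0 pq x y [b hb xb] [c hc yc].
  exists (p *: b + q *: c).
    by have /convex_setP := @convex_hull_convex _ _ B'; apply.
  rewrite opprD addrACA -!scalerBr (le_lt_trans (ler_normD _ _))// !normrZ.
  rewrite !ger0_norm// -[ltRHS]mul1r -pq mulrDl.
  have [p_eq0|pN0] := eqVneq p 0.
    have q1 : q = 1 by lra.
    by rewrite p_eq0 !mul0r !add0r q1 !mul1r.
  by rewrite ltr_leD// ?ltr_pM2l ?ler_wpM2l ?lt0r ?pN0// ltW.
move=> /[dup] AB /hausdorff_near_sym BA.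
split; first by apply: half; case: AB.
move=> b /(half _ _ BA.1)[a Aa].
by exists a; rewrite // distrC.
Qed.

End hausdorff_near.

Section hausdorff_continuity.
Context {R : realType} {T : topologicalType} {V : normedModType R}.
Variable U : set T.
Implicit Types F G : T -> set V.

(** Hausdorff continuity without the extended-real distance: for nonempty
    values it is equivalent to [hausdorff_continuous]. *)
Definition hausdorff_near_continuous F := forall x, U x ->
  forall e, 0 < e -> \forall y \near within U (nbhs x), hausdorff_near e (F y) (F x).

Lemma hausdorff_continuousP F : (forall x, U x -> F x !=set0) ->
  hausdorff_continuous U F <-> hausdorff_near_continuous F.
Proof.
move=> F0; split=> cF x Ux.
  move=> e e0.
  have /fine_cvgP[dfin /cvgr_lt/(_ _ e0)] := cF x Ux.
  apply: filterS2 dfin => y yfin /= de.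
  by apply: hausdorff_dist_near; rewrite -(fineK yfin) lte_fin.
have nearF e : 0 < e -> \forall y \near within U (nbhs x),
    (0 <= hausdorff_dist (F y) (F x) <= e%:E)%E.
  move=> e0; near=> y; apply: hausdorff_near_dist; last 1 first.
  - by near: y; exact: cF.
  - by apply: F0; near: y; exact: withinT.
apply/fine_cvgP; split.
  apply: filterS (nearF 1 ltr01) => y /andP[d0 d1].
  by rewrite ge0_fin_numE// (le_lt_trans d1)// ltry.
apply/cvgrPdist_le => e e0; apply: filterS (nearF e e0) => y /andP[d0 de] /=.
rewrite sub0r normrN ger0_norm ?fine_ge0// -lee_fin fineK//.
by rewrite ge0_fin_numE// (le_lt_trans de)// ltry.
Unshelve. all: by end_near. Qed.

Lemma hausdorff_near_continuous_set1 (c : T -> V) :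
  (forall x, U x -> c y @[y --> within U (nbhs x)] --> c x) ->
  hausdorff_near_continuous (fun x => [set c x]).
Proof.
move=> cc x Ux e e0.
have /cvgrPdist_lt/(_ e e0) := cc x Ux; apply: filterS => y yx.
by split=> _ ->; [exists (c x)|exists (c y)]; rewrite // distrC.
Qed.

Lemma hausdorff_near_continuous_add F G :
  hausdorff_near_continuous F -> hausdorff_near_continuous G ->
  hausdorff_near_continuous (fun x => set_add (F x) (G x)).
Proof.
move=> cF cG x Ux e e0; have e20 : 0 < e / 2 by rewrite divr_gt0.
apply: filterS2 (cF x Ux _ e20) (cG x Ux _ e20) => y nF nG.
by rewrite [e]splitr; exact: hausdorff_near_add.
Qed.

Lemma hausdorff_near_continuous_sum (I : Type) (s : seq I) (P : pred I)
    (F : I -> T -> set V) :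
  (forall i, hausdorff_near_continuous (F i)) ->
  hausdorff_near_continuous
    (fun x => \big[set_add/[set 0]]_(i <- s | P i) F i x).
Proof.
move=> cF; elim: s => [|i s IHs].
  under eq_fun do rewrite big_nil.
  by apply: hausdorff_near_continuous_set1 => x _; exact: cvg_cst.
under eq_fun do rewrite big_cons.
by case: (P i) => //; exact: hausdorff_near_continuous_add.
Qed.

Lemma hausdorff_near_continuous_opp F : hausdorff_near_continuous F ->
  hausdorff_near_continuous (fun x => set_opp (F x)).
Proof.
move=> cF x Ux e e0; apply: filterS (cF x Ux e e0) => y.
exact: hausdorff_near_opp.
Qed.

Lemma hausdorff_near_continuous_hull (I : finType) (F : I -> T -> set V) :
  (forall i, hausdorff_near_continuous (F i)) ->
  hausdorff_near_continuous (fun x => convex_hull (\bigcup_i F i x)).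
Proof.
move=> cF x Ux e e0.
have : \forall y \near within U (nbhs x),
    forall i, hausdorff_near e (F i y) (F i x).
  by apply: filter_forall => i; exact: cF.
by apply: filterS => y nF; apply/hausdorff_near_hull/hausdorff_near_bigcup.
Qed.

End hausdorff_continuity.

(** * Inner products and affine forms *)

Section inner_product.
Context {R : realType} {H : hilbertType R}.
Implicit Types u v w : H.

Lemma innerDl u v w : '[u + v, w] = '[u, w] + '[v, w].
Proof. by rewrite linearDl. Qed.

Lemma innerZl (a : R) u w : '[a *: u, w] = a * '[u, w].
Proof. by rewrite linearZl_LR. Qed.

Lemma innerBl u v w : '[u - v, w] = '[u, w] - '[v, w].
Proof. by rewrite linearBl. Qed.

Lemma innerBr u v w : '[u, v - w] = '[u, v] - '[u, w].
Proof. by rewrite linearBr. Qed.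

Lemma innerC u v : '[u, v] = '[v, u].
Proof. by rewrite hermC expr0 mul1r. Qed.

Lemma innerZr (a : R) u w : '[u, a *: w] = a * '[u, w].
Proof. by rewrite innerC innerZl innerC. Qed.

Lemma innerDr u v w : '[u, v + w] = '[u, v] + '[u, w].
Proof. by rewrite linearDr. Qed.

Lemma innerNl u v : '[- u, v] = - '[u, v].
Proof. by rewrite linearNl. Qed.

Lemma inner_le u v : '[u, v] <= `|u| * `|v|.
Proof.
have [->|u0] := eqVneq u 0; first by rewrite linear0l normr0 mul0r.
have [->|v0] := eqVneq v 0; first by rewrite linear0r normr0 mulr0.
have a_gt0 : 0 < `|u| by rewrite normr_gt0.
have b_gt0 : 0 < `|v| by rewrite normr_gt0.
(* The square of the norm of |v| u - |u| v is 2 |u| |v| (|u| |v| - <u, v>). *)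
have : 0 <= `| `|v| *: u - `|u| *: v| ^+ 2 by rewrite exprn_ge0.
rewrite -inner_normE innerBr !innerBl !innerZl !innerZr !inner_normE.
rewrite ['[v, u]]innerC => sq_ge0.
have ab_gt0 : 0 < `|u| * `|v| by rewrite mulr_gt0.
rewrite -(ler_pM2l ab_gt0); lra.
Qed.

Lemma norm_inner_le u v : `|'[u, v]| <= `|u| * `|v|.
Proof.
by rewrite ler_norml inner_le andbT lerNl -linearNr -(normrN v) inner_le.
Qed.

End inner_product.

Section affine_form.
Context {R : realType} {H : hilbertType R}.
Local Notation RH := (R^o * H)%type.
Variables (alpha : R) (h : H).

(** The functional whose extrema over the two sets of a codifferential
    approximate the increment of the function along h; for alpha = 0 it is the
    first projection, which governs normalization. *)
Definition affine_form (z : RH) : R^o := z.1 + alpha * '[z.2, h].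

Lemma affine_form_is_linear : linear affine_form.
Proof.
move=> a [b u] [c v]; rewrite /affine_form /= innerDl innerZl.
suff mulE (s t : R) :
    a * b + c + alpha * (a * s + t) = a * (b + alpha * s) + (c + alpha * t).
  exact: mulE.
by ring.
Qed.

HB.instance Definition _ :=
  GRing.isLinear.Build R RH R^o _ affine_form affine_form_is_linear.

Lemma affine_form_continuous : continuous affine_form.
Proof.
apply: bounded_linear_continuous; apply/bounded_funP => r.
exists (r + `|alpha| * (r * `|h|)) => -[b u].
rewrite prod_normE ge_max /= => /andP[br ur].
rewrite (le_trans (ler_normD _ _))// lerD// normrM ler_wpM2l//.
by rewrite (le_trans (norm_inner_le _ _))// ler_wpM2r.
Qed.

Lemma affine_form_vertical (c : R) : affine_form (c, 0) = c.
Proof. by rewrite /affine_form linear0l mulr0 addr0. Qed.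

Definition affine_functional : topological_dual RH :=
  exist _ (affine_form : {linear RH -> R^o}) affine_form_continuous.

End affine_form.

Lemma fst_imageE (R : realType) (H : hilbertType R) (C : set (R^o * H)) :
  [set z.1 | z in C] = affine_form 0 0 @` C :> set R.
Proof. by apply: eq_imagel => z _; rewrite /affine_form mul0r addr0. Qed.

Section weakly_compact_convex.
Context {R : realType} {H : hilbertType R}.
Local Notation RH := (R^o * H)%type.
Implicit Types (A B C : set RH).

Lemma weakly_compact_convex_set1 (z : RH) : weakly_compact_convex [set z].
Proof.
split; [by exists z| |exact: convex_set1].
exact: (@compact_set1 (initial_topology (@dual_eval R RH))).
Qed.

Lemma weakly_compact_convex_add A B : weakly_compact_convex A ->
  weakly_compact_convex B -> weakly_compact_convex (set_add A B).
Proof.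
move=> [[a Aa] cA cvA] [[b Bb] cB cvB]; split.
- by exists (a + b); exists a => //; exists b.
- exact: weakly_compact_add.
- exact: convex_set_add.
Qed.

Lemma weakly_compact_convex_opp A :
  weakly_compact_convex A -> weakly_compact_convex (set_opp A).
Proof.
move=> [[a Aa] cA cvA]; split; first by exists (- a); exists a.
  exact: weakly_compact_opp.
exact: convex_set_opp.
Qed.

Lemma weakly_compact_convex_sum (I : Type) (s : seq I) (P : pred I)
    (C : I -> set RH) :
  (forall i, weakly_compact_convex (C i)) ->
  weakly_compact_convex (\big[set_add/[set 0]]_(i <- s | P i) C i).
Proof.
move=> cC; apply: big_ind => //; first exact: weakly_compact_convex_set1.
exact: weakly_compact_convex_add.
Qed.

Lemma weakly_compact_convex_hull m (C : 'I_m.+1 -> set RH) :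
  (forall i, weakly_compact_convex (C i)) ->
  weakly_compact_convex (convex_hull (\bigcup_i C i)).
Proof.
move=> cC; split.
- have [[z Cz] _ _] := cC ord0.
  by exists z; apply: sub_convex_hull; exists ord0.
- by apply: weakly_compact_hull_bigcup => i; case: (cC i).
- exact: convex_hull_convex.
Qed.

Lemma weakly_compact_convex_greatest alpha h C : weakly_compact_convex C ->
  is_greatest (affine_form alpha h @` C) (set_max (affine_form alpha h @` C)).
Proof.
by move=> [C0 cC _]; exact: (weakly_compact_greatest (affine_functional alpha h)).
Qed.

End weakly_compact_convex.

(** * Codifferentials of opposites and maxima *)

Section negation.
Context {R : realType} {H : hilbertType R}.
Local Notation codiff_pair := (@codiff_pair R H).
Implicit Types (f : H -> R) (D : codiff_pair) (x : H).

(** The codifferential of - f that corresponds to one of f: taking opposites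
    exchanges maxima and minima, hence the two sets. *)
Definition opp_codiff D : codiff_pair := (set_opp D.2, set_opp D.1).

Lemma codiff_remainder_opp f D x dx alpha :
  codiff_remainder (fun y => - f y) (opp_codiff D) x dx alpha =
  - codiff_remainder f D x dx alpha.
Proof.
rewrite /codiff_remainder /= -!/(affine_form _ _ @` _).
rewrite !(set_min_linear (affine_form alpha dx)) set_oppK; ring.
Qed.

Lemma normalized_opp D : normalized D -> normalized (opp_codiff D).
Proof.
rewrite /normalized !fst_imageE => -[max0 min0].
rewrite !(set_min_linear (affine_form 0 0)) /= in min0 *.
by rewrite set_oppK max0 oppr0; split=> //; rewrite -[LHS]opprK min0 oppr0.
Qed.

Lemma is_codifferential_opp f x D : is_codifferential f x D ->
  is_codifferential (fun y => - f y) x (opp_codiff D).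
Proof.
move=> [c1 c2 lim0 sum0]; split => /=; try exact: weakly_compact_convex_opp.
  move=> dx; under eq_fun do rewrite codiff_remainder_opp normrN.
  exact: lim0.
move: sum0; rewrite !fst_imageE !(set_min_linear (affine_form 0 0)) /= set_oppK.
by lra.
Qed.

End negation.

Section maximum.
Context {R : realType} {H : hilbertType R} (m : nat).
Variables (f_ : 'I_m.+1 -> H -> R) (D_ : 'I_m.+1 -> H -> @codiff_pair R H).
Variable x : H.
Hypothesis lowerD : forall i, weakly_compact_convex (D_ i x).1.
Hypothesis upperD : forall i, weakly_compact_convex (D_ i x).2.

Local Notation smax i alpha h := (set_max (affine_form alpha h @` (D_ i x).1)).
Local Notation smin i alpha h := (set_min (affine_form alpha h @` (D_ i x).2)).

Lemma max_codiff_lower_set i :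
  weakly_compact_convex (set_sub
    (set_add [set (f_ i x - max_fun f_ x, 0) : R^o * H] (D_ i x).1)
    (\big[set_add/[set 0]]_(j < m.+1 | j != i) (D_ j x).2)).
Proof.
rewrite set_subE; apply: weakly_compact_convex_add.
  by apply: weakly_compact_convex_add => //; exact: weakly_compact_convex_set1.
by apply: weakly_compact_convex_opp; exact: weakly_compact_convex_sum.
Qed.

Lemma max_codiff_weakly_compact_convex :
  weakly_compact_convex (max_codiff f_ D_ x).1 /\
  weakly_compact_convex (max_codiff f_ D_ x).2.
Proof.
split; first by apply: weakly_compact_convex_hull; exact: max_codiff_lower_set.
exact: weakly_compact_convex_sum.
Qed.

Lemma max_codiff_upper alpha h :
  set_min (affine_form alpha h @` (max_codiff f_ D_ x).2) =
  \sum_i smin i alpha h.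
Proof.
rewrite set_min_linear /= set_opp_sum.
rewrite (is_greatest_max (M := \sum_i - smin i alpha h)).
  by rewrite sumrN opprK.
apply: is_greatest_sum => i _; rewrite set_min_linear opprK.
exact/weakly_compact_convex_greatest/weakly_compact_convex_opp.
Qed.

Lemma max_codiff_lower alpha h :
  set_max (affine_form alpha h @` (max_codiff f_ D_ x).1) =
  fin_max (fun i => f_ i x + (smax i alpha h + smin i alpha h))
  - max_fun f_ x - \sum_i smin i alpha h.
Proof.
rewrite -addrA -fin_maxDr.
apply: is_greatest_max; apply: is_greatest_hull; apply: is_greatest_bigcup => i.
rewrite set_subE set_opp_sum.
rewrite [X in is_greatest _ X](_ : _ =
    f_ i x - max_fun f_ x + smax i alpha h + \sum_(j | j != i) - smin j alpha h).
  apply: is_greatest_add; [apply: is_greatest_add|].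
  - have := is_greatest_set1 (affine_form alpha h) (f_ i x - max_fun f_ x, 0).
    by rewrite /= affine_form_vertical.
  - exact: weakly_compact_convex_greatest.
  - apply: is_greatest_sum => j _; rewrite set_min_linear opprK.
    exact/weakly_compact_convex_greatest/weakly_compact_convex_opp.
by rewrite [in LHS](bigD1 i)//= sumrN; ring.
Qed.

(** The sum of the minima is the same for all i, so subtracting it in the lower
    set and adding it back through the upper set recovers the approximations
    of the f_i under the maximum. *)
Lemma max_codiff_remainder dx alpha :
  codiff_remainder (max_fun f_) (max_codiff f_ D_ x) x dx alpha =
  max_fun f_ (x + alpha *: dx) -
  fin_max (fun i => f_ i x + (smax i alpha dx + smin i alpha dx)).
Proof.
rewrite /codiff_remainder -!/(affine_form _ _ @` _).
by rewrite max_codiff_lower max_codiff_upper; ring.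
Qed.

Lemma max_codiff_remainder_le dx alpha M :
  (forall i, `|codiff_remainder (f_ i) (D_ i x) x dx alpha| <= M) ->
  `|codiff_remainder (max_fun f_) (max_codiff f_ D_ x) x dx alpha| <= M.
Proof.
move=> remM; rewrite max_codiff_remainder; apply: fin_max_dist => i.
by rewrite !opprD !addrA; exact: remM.
Qed.

Hypothesis normD : forall i, normalized (D_ i x).

Lemma max_codiff_normalized : normalized (max_codiff f_ D_ x).
Proof.
have min0 i : smin i 0 0 = 0 by have [_] := normD i; rewrite fst_imageE.
have max0 i : smax i 0 0 = 0 by have [+ _] := normD i; rewrite fst_imageE.
rewrite /normalized !fst_imageE max_codiff_lower max_codiff_upper.
rewrite big1// subr0; split=> //; apply/eqP; rewrite subr_eq0; apply/eqP.
by congr fin_max; apply/funext => i; rewrite min0 max0 !addr0.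
Qed.

Lemma max_codiff_codifferential :
  (forall i, is_codifferential (f_ i) x (D_ i x)) ->
  is_codifferential (max_fun f_) x (max_codiff f_ D_ x).
Proof.
move=> codifD; have [lower upper] := max_codiff_weakly_compact_convex.
split=> // [dx|]; last first.
  by have [-> ->] := max_codiff_normalized; rewrite addr0.
apply/cvgrPdist_le => e e0.
have : \forall alpha \near 0^'+, forall i,
    `|0 - alpha^-1 * `|codiff_remainder (f_ i) (D_ i x) x dx alpha| | <= e.
  apply: filter_forall => i; have [_ _ /(_ dx) lim0 _] := codifD i.
  by move/cvgrPdist_le : lim0; exact.
apply: filterS2 (nbhs_right_gt 0) => alpha alpha0 /= rem_le.
have aV : 0 < alpha^-1 by rewrite invr_gt0.
have rem_leP r : (`|0 - alpha^-1 * `|r| | <= e) = (`|r| <= alpha * e).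
  by rewrite sub0r normrN normrM normr_id gtr0_norm// ler_pdivrMl.
by rewrite rem_leP; apply: max_codiff_remainder_le => i; rewrite -rem_leP.
Qed.

End maximum.

(** * Continuity of continuously codifferentiable functions *)

Section mean_value_inequality.
Context {R : realType}.

(** Only the increments between t and its neighbours are controlled, so phi
    need not be differentiable.  The supremum c of the points up to which the
    inequality with slope K holds is itself such a point, and it could be
    increased if it were less than 1. *)
Lemma mean_value_le (phi : R -> R) (K : R) :
  (forall t, 0 <= t <= 1 -> exists2 d, 0 < d &
     forall s, `|s - t| < d -> `|phi s - phi t| <= K * `|s - t|) ->
  `|phi 1 - phi 0| <= K.
Proof.
move=> local.
pose S := [set t : R | 0 <= t <= 1 /\ `|phi t - phi 0| <= K * t].
have S0 : S 0 by split; rewrite ?lexx ?ler01// subrr normr0 mulr0.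
have S1 : ubound S 1 by move=> t [/andP[]].
have supS : has_sup S by split; [exists 0|exists 1].
set c := sup S.
have c01 : 0 <= c <= 1.
  by rewrite sup_upper_bound//= ge_sup//; exists 0.
have [d d0 dP] := local c c01.
have Sc : S c.
  split=> //; have [t St ct] := sup_adherent d0 supS.
  rewrite -/c in ct; have tc : t <= c by exact: sup_upper_bound.
  have [t01 phit] := St.
  have /dP : `|t - c| < d by rewrite ltr_norml; lra.
  rewrite (ler0_norm (_ : t - c <= 0)) ?subr_le0// distrC => phic.
  rewrite -(subrKA (phi t)) (le_trans (ler_normD _ _))//.
  rewrite (le_trans (lerD phic phit))//; lra.
have [c1|c_neq1] := eqVneq c 1; first by have [_] := Sc; rewrite c1 mulr1.
have c_lt1 : c < 1 by rewrite lt_neqAle c_neq1; case/andP: c01.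
pose s := Num.min 1 (c + d / 2).
have cs : c < s by rewrite lt_min c_lt1 ltrDl divr_gt0.
have s1 : s <= 1 by rewrite ge_min lexx.
have scd : s <= c + d / 2 by rewrite ge_min lexx orbT.
suff /(sup_upper_bound supS) : S s by rewrite leNgt cs.
split; first by move: c01 => /andP[c0 _]; rewrite s1 (le_trans c0)// ltW.
have /dP : `|s - c| < d by rewrite ltr_norml; lra.
have sc0 : 0 <= s - c by rewrite subr_ge0 ltW.
rewrite (ger0_norm sc0) => phis.
have [_ phic] := Sc.
rewrite -(subrKA (phi c)) (le_trans (ler_normD _ _))//.
rewrite (le_trans (lerD phis phic))//; lra.
Qed.

End mean_value_inequality.

Section continuity.
Context {R : realType} {H : hilbertType R}.
Local Notation RH := (R^o * H)%type.
Implicit Types (C : set RH) (f : H -> R) (U : set H).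

Lemma affine_form_bounded alpha (h : H) C : weakly_compact_convex C ->
  exists M, forall z, C z -> `|affine_form alpha h z : R| <= M.
Proof.
move=> cC; have cN := weakly_compact_convex_opp cC.
have /is_greatest_image[_ uC] := weakly_compact_convex_greatest alpha h cC.
have /is_greatest_image[_ uN] := weakly_compact_convex_greatest alpha h cN.
set M := set_max _ in uC; set N := set_max _ in uN.
exists (Num.max M N) => z Cz; rewrite ler_norml lerNl !le_max uC// andbT.
have := uN (- z); rewrite linearN => -> //; first by rewrite orbT.
by exists z.
Qed.

(** Weak compactness gives a bound for each direction h; the uniform
    boundedness principle makes it uniform over the unit ball. *)
Lemma weakly_compact_inner_bounded C : weakly_compact_convex C ->
  exists2 M, 0 <= M & forall z h, C z -> `|'[z.2, h]| <= M * `|h|.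
Proof.
move=> cC; pose F : set (H -> R^o) := [set (fun h => '[z.2, h]) | z in C].
have linF g : F g -> bounded_fun_norm g /\ linear g.
  move=> [z Cz <-]; split=> [r|a u v].
    exists (`|z.2| * r) => h hr.
    by rewrite (le_trans (norm_inner_le _ _))// ler_wpM2l.
  by rewrite innerDr innerZr.
have ptwsF : pointwise_bounded F.
  move=> h; have [M1 M1P] := affine_form_bounded 1 h cC.
  have [M0 M0P] := affine_form_bounded 0 0 cC.
  exists (M1 + M0) => _ [z Cz <-].
  have -> : '[z.2, h] = (affine_form 1 h z : R) - affine_form 0 0 z.
    by rewrite /affine_form mul1r mul0r addr0 addrAC subrr add0r.
  by rewrite (le_trans (ler_normB _ _))// lerD ?M1P ?M0P.
have [M MP] := Banach_Steinhauss linF ptwsF 1.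
have [z0 Cz0] : C !=set0 by case: cC.
exists M.
  have Fz0 : F (fun h => '[z0.2, h]) by exists z0.
  by rewrite (le_trans _ (MP _ Fz0 0 _)) ?normr0.
move=> z h Cz; have [->|h0] := eqVneq h 0.
  by rewrite linear0r !normr0 mulr0.
have nh : 0 < `|h| by rewrite normr_gt0.
have Fz : F (fun h => '[z.2, h]) by exists z.
have := MP _ Fz (`|h|^-1 *: h); rewrite normrZ normfV normr_id mulVf ?gt_eqF//.
move=> /(_ (lexx _)); rewrite innerZr normrM normfV normr_id.
by rewrite ler_pdivrMl// mulrC.
Qed.

(** Normalization makes all first components nonpositive, with 0 attained, so
    that, up to the factor alpha, the maximum is at most the largest of the
    scalar products with h and at least one of them. *)
Lemma set_max_increment C L alpha (h : H) : weakly_compact_convex C ->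
  set_max [set z.1 | z in C] = 0 ->
  (forall z, C z -> `|'[z.2, h]| <= L) -> 0 <= alpha ->
  `|set_max (affine_form alpha h @` C)| <= alpha * L.
Proof.
move=> cC; rewrite fst_imageE => max0 CL alpha0.
have /is_greatest_image[[z1 Cz1 <-] max1] :=
  weakly_compact_convex_greatest alpha h cC.
have := weakly_compact_convex_greatest 0 0 cC.
rewrite max0 => /is_greatest_image[[z0 Cz0 z00] uC].
have z10 := uC _ Cz1.
have z0le := max1 _ Cz0.
rewrite /affine_form mul0r addr0 in z00 z10.
rewrite /affine_form z00 add0r in z0le *.
have := CL _ Cz1; have := CL _ Cz0.
rewrite !ler_norml => /andP[z0L _] /andP[_ z1L].
have := ler_wpM2l alpha0 z0L; have := ler_wpM2l alpha0 z1L.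
by rewrite mulrN; lra.
Qed.

Lemma set_min_increment C L alpha (h : H) : weakly_compact_convex C ->
  set_min [set z.1 | z in C] = 0 ->
  (forall z, C z -> `|'[z.2, h]| <= L) -> 0 <= alpha ->
  `|set_min (affine_form alpha h @` C)| <= alpha * L.
Proof.
move=> cC min0 CL alpha0; rewrite set_min_linear normrN.
apply: set_max_increment => //; first exact: weakly_compact_convex_opp.
  by move: min0; rewrite !fst_imageE set_min_linear => /eqP; rewrite oppr_eq0 => /eqP.
by move=> _ [z Cz <-]; rewrite innerNl normrN; exact: CL.
Qed.

Variables (U : set H) (f : H -> R) (Df : H -> @codiff_pair R H).
Hypothesis openU : open U.
Hypothesis cD : is_continuous_codifferential U f Df.

Lemma lower_near_continuous :
  hausdorff_near_continuous U (fun x => (Df x).1).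
Proof.
have [codif cD1 _] := cD; apply/hausdorff_continuousP => // x /codif[[[]]].
by [].
Qed.

Lemma upper_near_continuous :
  hausdorff_near_continuous U (fun x => (Df x).2).
Proof.
have [codif _ cD2] := cD; apply/hausdorff_continuousP => // x /codif[[_ []]].
by [].
Qed.

(** A vector within distance 1 of a set on which scalar products with h are at
    most M times the norm of h satisfies the same bound with M + 1, so the bound
    at x gives one at all nearby points. *)
Lemma locally_bounded_increment x : U x -> exists2 K, 0 <= K &
  \forall y \near x, forall h e, 0 < e -> \forall alpha \near 0^'+,
    `|f (y + alpha *: h) - f y| <= alpha * (K * `|h| + e).
Proof.
move=> Ux; have [codif _ _] := cD.
have [[lower upper _ _] _] := codif x Ux.
have [M1 M10 M1P] := weakly_compact_inner_bounded lower.
have [M2 M20 M2P] := weakly_compact_inner_bounded upper.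
exists (M1 + 1 + (M2 + 1)); first by lra.
have shift C C' M : hausdorff_near 1 C C' ->
    (forall z h, C' z -> `|'[z.2, h]| <= M * `|h|) ->
    forall h z, C z -> `|'[z.2, h]| <= (M + 1) * `|h|.
  move=> [CC' _] C'M h z /CC'[w C'w zw].
  rewrite -[z.2](subrK w.2) innerDl addrC mulrDl mul1r.
  rewrite (le_trans (ler_normD _ _))// lerD ?C'M//.
  rewrite (le_trans (norm_inner_le _ _))// -[leRHS]mul1r ler_wpM2r//.
  rewrite ltW// (le_lt_trans _ zw)// prod_normE le_max.
  by rewrite lexx orbT.
have nearU : within U (nbhs x) = nbhs x.
  by apply: within_interior; rewrite /interior; exact: open_nbhs_nbhs.
have near1 := lower_near_continuous Ux ltr01; rewrite nearU in near1.
have near2 := upper_near_continuous Ux ltr01; rewrite nearU in near2.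
near=> y => h e e0.
have Uy : U y by near: y; exact: open_nbhs_nbhs.
have n1 : hausdorff_near 1 (Df y).1 (Df x).1 by near: y.
have n2 : hausdorff_near 1 (Df y).2 (Df x).2 by near: y.
have [[lowy upy /(_ h) lim0 _] [max0 min0]] := codif y Uy.
move/cvgrPdist_le/(_ e e0): lim0; apply: filterS2 (nbhs_right_gt 0).
move=> alpha alpha0 /=.
rewrite sub0r normrN normrM normr_id gtr0_norm ?invr_gt0// ler_pdivrMl//.
rewrite /codiff_remainder -!/(affine_form _ _ @` _) => rem.
have := set_max_increment lowy max0 (shift _ _ _ n1 M1P h) (ltW alpha0).
have := set_min_increment upy min0 (shift _ _ _ n2 M2P h) (ltW alpha0).
move: rem; rewrite !ler_norml; lra.
Unshelve. all: by end_near. Qed.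

(** The mean value inequality on the segment from x to x + h, where the
    increments at the intermediate points are bounded with one constant. *)
Lemma continuous_codifferential_continuous x : U x -> {for x, continuous f}.
Proof.
move=> Ux; have [K K0 nearK] := locally_bounded_increment Ux.
move/nbhs_ballP : nearK => [d /= d0 dP].
have lip h e : 0 < e -> `|h| < d -> `|f (x + h) - f x| <= K * `|h| + e.
  move=> e0 hd; pose phi t := f (x + t *: h).
  have -> : f (x + h) - f x = phi 1 - phi 0.
    by rewrite /phi scale1r scale0r addr0.
  apply: mean_value_le => t /andP[t0 t1].
  have yx : ball x d (x + t *: h).
    rewrite -ball_normE /= opprD addrA subrr add0r normrN normrZ ger0_norm//.
    by rewrite (le_lt_trans _ hd)// ler_piMl.
  have /nbhs_ballP[d1 /= d10 d1P] := dP _ yx h e e0.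
  have /nbhs_ballP[d2 /= d20 d2P] := dP _ yx (- h) e e0.
  exists (Num.min d1 d2); first by rewrite lt_min d10.
  move=> s; rewrite lt_min => /andP[sd1 sd2].
  have [st|ts|->] := ltgtP s t; last by rewrite !subrr normr0 mulr0.
  - have ts0 : 0 < t - s by rewrite subr_gt0.
    have := d2P (t - s); rewrite -ball_normE /= sub0r normrN distrC.
    move=> /(_ sd2 ts0); rewrite -[phi t]/(f (x + t *: h)) normrN.
    rewrite scalerN -scaleNr opprB -addrA -scalerDl addrCA subrr addr0.
    by rewrite (distrC s t) (gtr0_norm ts0) mulrC.
  - have st0 : 0 < s - t by rewrite subr_gt0.
    have := d1P (s - t); rewrite -ball_normE /= sub0r normrN.
    move=> /(_ sd1 st0).
    rewrite -addrA -scalerDl addrCA subrr addr0.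
    by rewrite (gtr0_norm st0) mulrC.
apply/cvgrPdist_le => e e0.
have e20 : 0 < e / 2 by rewrite divr_gt0.
have K1 : 0 < K + 1 by rewrite ltr_wpDl.
near=> y; rewrite distrC -[y](subrKC x).
have yd : `|x - y| < d by near: y; exact: cvgr_dist_lt.
have ye : `|x - y| < e / 2 / (K + 1).
  by near: y; apply: cvgr_dist_lt => //; rewrite divr_gt0.
rewrite distrC in yd; rewrite distrC ltr_pdivlMr// in ye.
rewrite (le_trans (lip _ _ e20 yd))//.
have := normr_ge0 (y - x); lra.
Unshelve. all: by end_near. Qed.

End continuity.

(** * Continuous codifferentials of maxima and minima *)

Section continuous_codifferentials.
Context {R : realType} {H : hilbertType R}.
Implicit Types (U : set H) (f : H -> R).

Lemma is_continuous_codifferential_opp U f (Df : H -> @codiff_pair R H) :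
  is_continuous_codifferential U f Df ->
  is_continuous_codifferential U (fun x => - f x) (fun x => opp_codiff (Df x)).
Proof.
move=> cD; have [codif _ _] := cD.
have codifN x : U x -> is_codifferential (fun y => - f y) x (opp_codiff (Df x)).
  by move=> /codif[+ _]; exact: is_codifferential_opp.
split.
- by move=> x Ux; split; [exact: codifN|apply: normalized_opp; case: (codif x Ux)].
- apply/hausdorff_continuousP; first by move=> x /codifN[[]].
  exact/hausdorff_near_continuous_opp/(upper_near_continuous cD).
- apply/hausdorff_continuousP; first by move=> x /codifN[_ []].
  exact/hausdorff_near_continuous_opp/(lower_near_continuous cD).
Qed.

Lemma continuously_codifferentiableP U f Df :
  is_continuous_codifferential U f Df -> continuously_codifferentiable U f.
Proof.
move=> cD; split; last by exists Df.
by move=> x Ux; have [/(_ x Ux)[codif _] _ _] := cD; exists (Df x).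
Qed.

Variables (m : nat).
Implicit Types (fs : 'I_m.+1 -> H -> R) (Ds : 'I_m.+1 -> H -> @codiff_pair R H).

Lemma max_codiff_continuous U fs Ds : open U ->
  (forall i, is_continuous_codifferential U (fs i) (Ds i)) ->
  is_continuous_codifferential U (max_fun fs) (max_codiff fs Ds).
Proof.
move=> openU cD.
have codif i x : U x -> is_codifferential (fs i) x (Ds i x) /\ normalized (Ds i x).
  by case: (cD i) => + _ _; exact.
have wl i x : U x -> weakly_compact_convex (Ds i x).1 by move=> /(codif i)[[]].
have wu i x : U x -> weakly_compact_convex (Ds i x).2 by move=> /(codif i)[[]].
have wmax x : U x -> weakly_compact_convex (max_codiff fs Ds x).1 /\
    weakly_compact_convex (max_codiff fs Ds x).2.
  by move=> Ux; apply: max_codiff_weakly_compact_convex => i; [exact: wl|exact: wu].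
have cf i x : U x -> fs i y @[y --> within U (nbhs x)] --> fs i x.
  move=> Ux; apply: cvg_within_filter.
  exact: (continuous_codifferential_continuous openU (cD i)).
have cmax x : U x -> max_fun fs y @[y --> within U (nbhs x)] --> max_fun fs x.
  move=> Ux; apply/cvgrPdist_le => e e0.
  have : \forall y \near within U (nbhs x), forall i, `|fs i x - fs i y| <= e.
    by apply: filter_forall => i; have /cvgrPdist_le := cf i x Ux; exact.
  by apply: filterS => y; exact: fin_max_dist.
split.
- move=> x Ux.
  have wlx i := wl i x Ux; have wux i := wu i x Ux.
  have normx i := (codif i x Ux).2; have codifx i := (codif i x Ux).1.
  by split; [exact: max_codiff_codifferential|exact: max_codiff_normalized].
- apply/hausdorff_continuousP; first by move=> x /wmax[[]].
  apply: hausdorff_near_continuous_hull => i.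
  under eq_fun do rewrite set_subE.
  apply: hausdorff_near_continuous_add.
    apply: hausdorff_near_continuous_add; last exact: (lower_near_continuous (cD i)).
    apply: hausdorff_near_continuous_set1 => x Ux.
    have : fs i y - max_fun fs y @[y --> within U (nbhs x)] -->
        fs i x - max_fun fs x by apply: cvgB; [exact: cf|exact: cmax].
    move=> /cvgrPdist_lt diff; apply/cvgrPdist_lt => e e0.
    apply: filterS (diff e e0) => y; rewrite prod_normE /= subrr normr0.
    by rewrite gt_max e0 andbT.
  apply/hausdorff_near_continuous_opp/hausdorff_near_continuous_sum => j.
  exact: (upper_near_continuous (cD j)).
- apply/hausdorff_continuousP; first by move=> x /wmax[_ []].
  apply: hausdorff_near_continuous_sum => j.
  exact: (upper_near_continuous (cD j)).
Qed.

Lemma min_funE fs : min_fun fs = fun x => - max_fun (fun i y => - fs i y) x.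
Proof. by apply/funext => x; exact: fin_minE. Qed.

(** Opposites commute with sums and convex hulls and exchange lower and upper
    sets, so all properties of the minimum follow from those of the maximum. *)
Lemma min_codiffE fs Ds : min_codiff fs Ds = fun x => opp_codiff
  (max_codiff (fun i y => - fs i y) (fun i y => opp_codiff (Ds i y)) x).
Proof.
apply/funext => x; rewrite /min_codiff /opp_codiff /max_codiff /=.
rewrite set_opp_sum; congr pair.
  by apply: eq_bigr => i _; rewrite set_oppK.
rewrite set_opp_convex_hull set_opp_bigcup; congr convex_hull.
apply: eq_bigcupr => i _; rewrite !set_subE !set_oppD !set_oppK set_opp1.
congr (set_add (set_add _ _) _); last by rewrite set_opp_sum.
rewrite min_funE; congr [set _]; rewrite opprK; congr pair => /=.
  by rewrite opprD !opprK.
by rewrite oppr0.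
Qed.

Lemma min_codiff_continuous U fs Ds : open U ->
  (forall i, is_continuous_codifferential U (fs i) (Ds i)) ->
  is_continuous_codifferential U (min_fun fs) (min_codiff fs Ds).
Proof.
move=> openU cD; rewrite min_funE min_codiffE.
apply: is_continuous_codifferential_opp; apply: max_codiff_continuous => // i.
exact: is_continuous_codifferential_opp.
Qed.

Lemma max_codiff_error_le fs Ds x dx alpha : 0 < alpha ->
  (forall i, weakly_compact_convex (Ds i x).1) ->
  (forall i, weakly_compact_convex (Ds i x).2) ->
  `|codiff_error (max_fun fs) (max_codiff fs Ds x) x dx alpha| <=
  fin_max (fun i => `|codiff_error (fs i) (Ds i x) x dx alpha|).
Proof.
move=> alpha0 wl wu; set M := fin_max _.
have errE f D : (`|codiff_error f D x dx alpha| <= M) =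
    (`|codiff_remainder f D x dx alpha| <= alpha * M).
  by rewrite normrM gtr0_norm ?invr_gt0// ler_pdivrMl.
rewrite errE; apply: max_codiff_remainder_le => // i; rewrite -errE.
exact: (fin_max_ge (fun i => `|codiff_error (fs i) (Ds i x) x dx alpha|)).
Qed.

Lemma min_codiff_error_le fs Ds x dx alpha : 0 < alpha ->
  (forall i, weakly_compact_convex (Ds i x).1) ->
  (forall i, weakly_compact_convex (Ds i x).2) ->
  `|codiff_error (min_fun fs) (min_codiff fs Ds x) x dx alpha| <=
  fin_max (fun i => `|codiff_error (fs i) (Ds i x) x dx alpha|).
Proof.
move=> alpha0 wl wu.
have errN f D : `|codiff_error (fun y => - f y) (opp_codiff D) x dx alpha| =
    `|codiff_error f D x dx alpha|.
  by rewrite /codiff_error codiff_remainder_opp mulrN normrN.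
rewrite min_funE min_codiffE errN.
under [X in _ <= fin_max X]eq_fun do rewrite -errN.
apply: (@max_codiff_error_le (fun i y => - fs i y)
  (fun i y => opp_codiff (Ds i y))) => // i; exact: weakly_compact_convex_opp.
Qed.

End continuous_codifferentials.

Theorem theorem1 (R : realType) (H : hilbertType R) (U : set H)
    (openU : open U) (m : nat) (f_ : 'I_m.+1 -> H -> R)
    (ccf : forall i, continuously_codifferentiable U (f_ i)) :
  [/\ continuously_codifferentiable U (max_fun f_),
      continuously_codifferentiable U (min_fun f_) &
      forall D_ : 'I_m.+1 -> H -> codiff_pair,
        (forall i, is_continuous_codifferential U (f_ i) (D_ i)) ->
        [/\ is_continuous_codifferential U (max_fun f_) (max_codiff f_ D_),
            is_continuous_codifferential U (min_fun f_) (min_codiff f_ D_) &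
            forall (x : H) (r : R) (dx : H) (alpha : R),
              U x -> 0 < r -> closed_ball_ (fun z : H => `|z|) x r `<=` U ->
              closed_ball_ (fun z : H => `|z|) 0 r dx -> 0 < alpha -> alpha <= 1 ->
              Num.max
                `|codiff_error (max_fun f_) (max_codiff f_ D_ x) x dx alpha|
                `|codiff_error (min_fun f_) (min_codiff f_ D_ x) x dx alpha|
              <= fin_max
                   (fun i => `|codiff_error (f_ i) (D_ i x) x dx alpha|)]].
Proof.
have optimal D_ (cD : forall i, is_continuous_codifferential U (f_ i) (D_ i)) :=
  (max_codiff_continuous openU cD, min_codiff_continuous openU cD).
have /choice[D0 cD0] i : exists Df, is_continuous_codifferential U (f_ i) Df.
  by case: (ccf i).
have [cmax cmin] := optimal D0 cD0.
split; [exact: continuously_codifferentiableP cmax|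
        exact: continuously_codifferentiableP cmin|].
move=> D_ cD; have [{}cmax {}cmin] := optimal D_ cD.
split=> // x r dx alpha Ux _ _ _ alpha0 _.
have wl i : weakly_compact_convex (D_ i x).1.
  by have [/(_ x Ux)[[]]] := cD i.
have wu i : weakly_compact_convex (D_ i x).2.
  by have [/(_ x Ux)[[]]] := cD i.
by rewrite ge_max max_codiff_error_le// min_codiff_error_le.
Qed.
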